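(* Let $\alpha>0$ be fixed and let $n\geq 1$ be an integer. Let $f,g\in\mathbb{C}^{2n-1}$ be two discrete signals with support in $\{0,\dots,n-1\}$: $$f[s]=g[s]=0\quad\text{for } s=n,\dots,2n-2 .$$ If $|\hat f|=|\hat g|$ and $\big|\widehat{f[s]e^{-s\alpha}}\big|=\big|\widehat{g[s]e^{-s\alpha}}\big|$, then, for some $\phi\in\mathbb{R}$, $$f=e^{i\phi}g .$$
   Context: Signals in $\mathbb{C}^{2n-1}$ are indexed by $s=0,\dots,2n-2$. The hat denotes the discrete Fourier transform of length $2n-1$: $\hat f[k]=\sum_{s=0}^{2n-2}f[s]e^{-2\pi i sk/(2n-1)}$ for $k$ ranging over a complete set of residues modulo $2n-1$. $\widehat{f[s]e^{-s\alpha}}$ is the discrete Fourier transform of the signal $s\mapsto f[s]e^{-s\alpha}$. Moduli are entrywise. *)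

(* Defs.v *)
From mathcomp Require Import all_boot all_order all_algebra.
From mathcomp Require Import reals sequences exp trigo.
From mathcomp Require Export complex.

Set Implicit Arguments.
Unset Strict Implicit.
Unset Printing Implicit Defensive.

Import Order.TTheory GRing.Theory Num.Theory.

Local Open Scope ring_scope.
Local Open Scope complex_scope.

(* $e^{it}$ for real t. *)
Definition expi (R : realType) (t : R) : R[i] := cos t +i* sin t.

(* The residues modulo N are represented by 0, ..., N-1. *)
Definition dft (R : realType) (N : nat) (f : 'rV[R[i]]_N) : 'rV[R[i]]_N :=
  \row_(k < N) \sum_(s < N)
     f 0 s * expi (- (2 * pi * (s : nat)%:R * (k : nat)%:R / N%:R)).

Definition damp (R : realType) (N : nat) (alpha : R) (f : 'rV[R[i]]_N) :
    'rV[R[i]]_N :=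
  \row_(s < N) (f 0 s * (expR (- ((s : nat)%:R * alpha)))%:C).

Definition modulus (R : realType) (N : nat) (f : 'rV[R[i]]_N) :
    'rV[R[i]]_N :=
  map_mx Num.norm f.

(* Main.v *)
Require Import Defs.
From mathcomp Require Import all_boot all_order all_algebra.
From mathcomp Require Import reals.
From mathcomp Require Import sequences exp trigo lra.

(** Identify a signal f supported on 0, ..., m with the polynomial
    P(z) = \sum_s f[s] z^s of degree at most m, and let P*(z) be its conjugate
    reciprocal, so that P*(w) = w^m conj(P(w)) on the unit circle.  Then
    P P* has degree at most 2m and equals w^m |P(w)|^2 at w = e^{-2 i pi k/N},
    where N = 2m+1.  These are N distinct points, so the modulus of the
    discrete Fourier transform determines P P* as a polynomial
    ([eq_autocorrelation]).

    The damped signal has polynomial P(rz), with r = e^{-alpha}, and the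
    reciprocal of P(rz) is r^m P*(z/r).  After the substitution z -> z/r, the
    second hypothesis says that P(z) P*(az) = Q(z) Q*(az), where a = r^{-2}
    and Q is the polynomial of g.  Together with P P* = Q Q* this gives,
    when P and Q are nonzero,

      P*(z) Q*(az) = P*(az) Q*(z),

    that is, the rational function P*/Q* is invariant under z -> az.  Since
    a > 0 and a <> 1, the powers of a are distinct, and comparing leading
    coefficients shows that such a function is constant
    ([dilate_cross_proportional]).  Hence P = c Q, and P P* = Q Q* forces
    |c| = 1. *)

Import Order.TTheory GRing.Theory Num.Theory.

Local Open Scope ring_scope.

(** * Dilation of polynomials *)

Definition dilate {K : comNzRingType} (a : K) (p : {poly K}) : {poly K} :=
  p \Po (a *: 'X).

Lemma coef_dilate (K : comNzRingType) (a : K) (p : {poly K}) (i : nat) :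
  (dilate a p)`_i = p`_i * a ^+ i.
Proof.
rewrite /dilate comp_polyE.
have -> : \sum_(j < size p) p`_j *: (a *: 'X) ^+ j
          = \poly_(j < size p) (p`_j * a ^+ j).
  by rewrite poly_def; apply: eq_bigr => j _; rewrite exprZn scalerA.
rewrite coef_poly; case: ltnP => // le_p_i.
by rewrite nth_default ?mul0r.
Qed.

Lemma dilateM (K : comNzRingType) (a : K) (p q : {poly K}) :
  dilate a (p * q) = dilate a p * dilate a q.
Proof. exact: comp_polyM. Qed.

Lemma dilate_dilate (K : comNzRingType) (a b : K) (p : {poly K}) :
  dilate a (dilate b p) = dilate (b * a) p.
Proof. by apply/polyP => i; rewrite !coef_dilate exprMn mulrA. Qed.

Lemma dilate1 (K : comNzRingType) (p : {poly K}) : dilate 1 p = p.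
Proof. by apply/polyP => i; rewrite coef_dilate expr1n mulr1. Qed.

Lemma dilateB (K : comNzRingType) (a : K) (p q : {poly K}) :
  dilate a (p - q) = dilate a p - dilate a q.
Proof. exact: comp_polyB. Qed.

Lemma dilateZ (K : comNzRingType) (a c : K) (p : {poly K}) :
  dilate a (c *: p) = c *: dilate a p.
Proof. exact: comp_polyZ. Qed.

Lemma lead_coef_dilate (K : idomainType) (a : K) (p : {poly K}) :
  a != 0 -> lead_coef (dilate a p) = lead_coef p * a ^+ (size p).-1.
Proof.
move=> a_neq0; have size_aX : size (a *: 'X) = 2 by rewrite size_scale ?size_polyX.
by rewrite lead_coef_comp ?size_aX // lead_coefZ lead_coefX mulr1.
Qed.

(** The leading coefficients of the two sides are those of p q, times a^(deg q)
    on the left and a^(deg p) on the right. *)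
Lemma eq_size_dilate_cross {K : numDomainType} {a : K} {p q : {poly K}} :
  0 < a -> a != 1 -> p != 0 -> q != 0 ->
  p * dilate a q = dilate a p * q -> size p = size q.
Proof.
move=> a_gt0 a_neq1 p_neq0 q_neq0 /(congr1 lead_coef).
rewrite !lead_coefM !lead_coef_dilate ?gt_eqF // mulrA -[RHS]mulrAC.
have lpq_neq0 : lead_coef p * lead_coef q != 0 by rewrite mulf_neq0 ?lead_coef_eq0.
move=> /(mulfI lpq_neq0) /(ieexprIn a_gt0 a_neq1) eq_deg.
by rewrite -(prednK (n := size p)) ?size_poly_gt0 // -eq_deg prednK ?size_poly_gt0.
Qed.

(** The solutions p of this equation, for fixed q, form a linear space in which
    nonzero elements have the degree of q.  Subtracting the multiple of q with
    the same leading coefficient as p lowers the degree, so it leaves 0. *)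
Lemma dilate_cross_proportional {K : numFieldType} {a : K} {p q : {poly K}} :
  0 < a -> a != 1 -> q != 0 -> p * dilate a q = dilate a p * q ->
  exists c, p = c *: q.
Proof.
move=> a_gt0 a_neq1 q_neq0 cross.
have [->|p_neq0] := eqVneq p 0; first by exists 0; rewrite scale0r.
have size_pq := eq_size_dilate_cross a_gt0 a_neq1 p_neq0 q_neq0 cross.
exists (lead_coef p / lead_coef q); set c := _ / _.
apply/eqP; rewrite -subr_eq0; apply/negPn/negP => d_neq0.
have : size (p - c *: q) = size q.
  apply: eq_size_dilate_cross a_gt0 a_neq1 d_neq0 q_neq0 _.
  rewrite dilateB dilateZ !mulrBl cross; congr (_ - _).
  by rewrite -!scalerAl mulrC.
have sz_gt0 : (0 < size q)%N by rewrite size_poly_gt0.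
suff : (size (p - c *: q)%R <= (size q).-1)%N.
  by move=> + eq_sz; rewrite eq_sz -ltnS prednK // ltnn.
apply/leq_sizeP => i; rewrite leq_eqVlt => /predU1P[<-|lt_i].
  rewrite coefB coefZ -{1}size_pq -!lead_coefE /c divfK ?subrr //.
  by rewrite lead_coef_eq0.
rewrite prednK // in lt_i.
by rewrite coefB coefZ !nth_default ?size_pq // mulr0 subrr.
Qed.

(** * Conjugate reciprocals and autocorrelations *)

(** This is z^m conj(p(1 / conj z)) when p has degree at most m.  The
    parameter m is not tied to the degree of p: a signal may vanish at
    the end of its support window. *)
Definition reciprocal {C : numClosedFieldType} (m : nat) (p : {poly C}) :
    {poly C} :=
  \poly_(j < m.+1) (p`_(m - j))^*.

Lemma reciprocalK {C : numClosedFieldType} {m : nat} {p : {poly C}} :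
  (size p <= m.+1)%N -> reciprocal m (reciprocal m p) = p.
Proof.
move=> le_p_m; apply/polyP => i; rewrite coef_poly coef_poly.
case: ltnP => [lt_i|le_i]; last by rewrite nth_default // (leq_trans le_p_m).
by rewrite ltnS leq_subr subKn // conjCK.
Qed.

Lemma reciprocalZ (C : numClosedFieldType) (m : nat) (c : C) (p : {poly C}) :
  reciprocal m (c *: p) = c^* *: reciprocal m p.
Proof.
apply/polyP => i; rewrite coefZ !coef_poly coefZ rmorphM.
by case: ifP; rewrite ?mulr0.
Qed.

Lemma reciprocal0 (C : numClosedFieldType) (m : nat) : reciprocal m (0 : {poly C}) = 0.
Proof. by rewrite -(scale0r 0) reciprocalZ conjC0 !scale0r. Qed.

Lemma horner_reciprocal (C : numClosedFieldType) (m : nat) (p : {poly C}) (w : C) :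
  (size p <= m.+1)%N -> `|w| = 1 -> (reciprocal m p).[w] = w ^+ m * (p.[w])^*.
Proof.
move=> le_p_m w1.
rewrite horner_poly (horner_coef_wide _ le_p_m) rmorph_sum mulr_sumr /=.
rewrite (reindex_inj rev_ord_inj) /=; apply: eq_bigr => i _.
have le_i : (i <= m)%N by rewrite -ltnS.
rewrite subSS subKn // rmorphM rmorphXn /= mulrCA; congr (_ * _).
have -> : w ^+ m = w ^+ (m - i) * w ^+ i by rewrite -exprD subnK // -ltnS.
by rewrite -mulrA -exprMn -normCK w1 !expr1n mulr1.
Qed.

(** Both products have degree at most 2m and take the values w^m |p(w)|^2 and
    w^m |q(w)|^2 on the unit circle, so 2m+1 sample points decide their
    equality. *)
Lemma eq_autocorrelation (C : numClosedFieldType) (m : nat) (p q : {poly C})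
    (ws : seq C) :
  (size p <= m.+1)%N -> (size q <= m.+1)%N ->
  uniq ws -> (m.*2 < size ws)%N ->
  (forall w, w \in ws -> `|w| = 1 /\ `|p.[w]| = `|q.[w]|) ->
  p * reciprocal m p = q * reciprocal m q.
Proof.
move=> le_p le_q ws_uniq ws_size eq_pq.
have size_auto (u : {poly C}) : (size u <= m.+1)%N ->
    (size (u * reciprocal m u)%R <= m.*2.+1)%N.
  move=> le_u; apply: leq_trans (size_polyMleq _ _) _.
  rewrite -subn1 leq_subLR add1n.
  have := leq_add le_u (size_poly m.+1 (fun j => (u`_(m - j))^*)).
  by rewrite addSn addnS addnn.
apply/eqP; rewrite -subr_eq0; apply/eqP.
apply: (@roots_geq_poly_eq0 _ _ ws) => //.
  apply/allP => w /eq_pq[w1 eqw]; rewrite rootE hornerD hornerN !hornerM.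
  rewrite !horner_reciprocal // ![_.[w] * (_ * _)]mulrCA -!normCK eqw.
  by rewrite subrr.
apply: leq_trans (size_polyD _ _) _; rewrite size_polyN geq_max.
by rewrite !(leq_trans (size_auto _ _)).
Qed.

(** Taking reciprocals turns a dilation by r into one by r^-1, so undoing the
    dilation by r in p leaves its reciprocal dilated by r^-2. *)
Lemma reciprocal_dilate (C : numClosedFieldType) (m : nat) (r : C) (p : {poly C}) :
  0 < r ->
  dilate r^-1 (reciprocal m (dilate r p))
  = r ^+ m *: dilate (r ^- 2) (reciprocal m p).
Proof.
move=> r_gt0; apply/polyP => j; rewrite coefZ !coef_dilate !coef_poly.
case: ltnP => [lt_j|]; last by rewrite !mul0r mulr0.
rewrite coef_dilate rmorphM rmorphXn /= (CrealP (gtr0_real r_gt0)).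
have -> : r ^+ m = r ^+ (m - j) * r ^+ j by rewrite -exprD subnK // -ltnS.
have -> : r^-1 ^+ j = r ^+ j * (r ^- 2) ^+ j.
  by rewrite -exprMn expr2 invfM mulrA divff ?mul1r // gt_eqF.
by rewrite [RHS]mulrACA [r ^+ (m - j) * _]mulrC.
Qed.

(** The first autocorrelation leaves the freedom to reflect some zeros of p in
    the unit circle, and the second the freedom to reflect zeros in the circle
    of radius r.  The two reflections compose to a dilation by a power of r,
    under which no finite set of nonzero points is invariant. *)
Lemma eq_up_to_phase_of_autocorrelations {C : numClosedFieldType} {m : nat}
    {r : C} {p q : {poly C}} :
  0 < r -> r != 1 -> (size p <= m.+1)%N -> (size q <= m.+1)%N ->
  p * reciprocal m p = q * reciprocal m q ->
  dilate r p * reciprocal m (dilate r p)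
  = dilate r q * reciprocal m (dilate r q) ->
  exists c : C, `|c| = 1 /\ p = c *: q.
Proof.
move=> r_gt0 r_neq1 le_p le_q eq_pq /(congr1 (dilate r^-1)).
have r_neq0 : r != 0 by rewrite gt_eqF.
rewrite !dilateM !dilate_dilate divff // !dilate1 !reciprocal_dilate //.
rewrite -!scalerAr => /(scalerI (expf_neq0 m r_neq0)).
set a := r ^- 2; have a_gt0 : 0 < a by rewrite invr_gt0 exprn_gt0.
have a_neq1 : a != 1.
  rewrite invr_eq1 sqrf_eq1 negb_or r_neq1 gt_eqF //.
  by rewrite (lt_trans _ r_gt0) // oppr_lt0.
have rec_eq0 (u : {poly C}) : (size u <= m.+1)%N -> reciprocal m u = 0 -> u = 0.
  by move=> le_u u0; rewrite -(reciprocalK le_u) u0 reciprocal0.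
have [q0|q_neq0] := eqVneq q 0.
  move=> _; exists 1; split; first exact: normr1.
  move/eqP: eq_pq; rewrite q0 mul0r mulf_eq0 scale1r => /orP[/eqP //|/eqP].
  exact: rec_eq0.
have rq_neq0 : reciprocal m q != 0 by apply: contra_neq q_neq0; apply: rec_eq0.
have auto_neq0 : q * reciprocal m q != 0 by rewrite mulf_neq0.
have p_neq0 : p != 0 by apply: contra_neq auto_neq0 => p0; rewrite -eq_pq p0 mul0r.
move=> eq_pqa.
have cross : reciprocal m p * dilate a (reciprocal m q)
             = dilate a (reciprocal m p) * reciprocal m q.
  (* Cross-multiply p p* = q q* with p(z) p*(az) = q(z) q*(az), cancel p q. *)
  apply: (mulfI (mulf_neq0 p_neq0 q_neq0)).
  rewrite [LHS]mulrACA eq_pq -eq_pqa.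
  by rewrite [LHS]mulrC mulrACA.
have [c eq_c] := dilate_cross_proportional a_gt0 a_neq1 rq_neq0 cross.
have eq_p : p = c^* *: q.
  by rewrite -(reciprocalK le_p) eq_c reciprocalZ reciprocalK.
exists c^*; split => //.
move/eqP: eq_pq; rewrite eq_p reciprocalZ conjCK -scalerAl -scalerAr scalerA.
rewrite -subr_eq0 -{2}(scale1r (q * _)) -scalerBl scaler_eq0 (negPf auto_neq0) orbF.
rewrite subr_eq0 mulrC -normCK norm_conjC => /eqP c2.
by apply/eqP; rewrite -(@eqrXn2 _ 2%N) ?normr_ge0 ?ler01 // c2 expr1n.
Qed.

Local Open Scope complex_scope.

(** * Unit complex numbers *)

Lemma expiD (R : realType) (x y : R) : expi (x + y) = expi x * expi y.
Proof. by rewrite /expi cosD sinD [sin x * _ + _]addrC. Qed.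

Lemma expi0 (R : realType) : expi (0 : R) = 1.
Proof. by rewrite /expi cos0 sin0. Qed.

Lemma expiX (R : realType) (x : R) (k : nat) : expi (x *+ k) = expi x ^+ k.
Proof. by elim: k => [|k IH]; rewrite ?mulr0n ?expi0 // mulrS expiD IH exprS. Qed.

Lemma norm_expi (R : realType) (x : R) : `|expi x| = 1.
Proof. by rewrite normc_def /= cos2Dsin2 sqrtr1. Qed.

Lemma expi_neq1 (R : realType) (x : R) : 0 < x < pi *+ 2 -> expi x != 1.
Proof.
move=> /andP[x_gt0 x_lt].
have sin_half : 0 < sin (x / 2).
  by rewrite sin_gt0_pi // divr_gt0 //= ltr_pdivrMr // mulr_natr.
have -> : x = (x / 2) *+ 2 by rewrite -[RHS]mulr_natr divfK ?pnatr_eq0.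
(* The real part of e^{ix} is cos(x/2)^2 - sin(x/2)^2, which is below 1. *)
apply/eqP => /(congr1 (@complex.Re R)); rewrite expiX expr2 /= -!expr2 => eq1.
by have := cos2Dsin2 (x / 2); have := exprn_gt0 2 sin_half; lra.
Qed.

Lemma norm1_expi (R : realType) (c : R[i]) : `|c| = 1 -> exists t : R, c = expi t.
Proof.
case: c => x y; rewrite normc_def /= => -[/eqP].
rewrite -(@eqrXn2 _ 2%N) ?sqrtr_ge0 ?ler01 //.
rewrite sqr_sqrtr ?addr_ge0 ?sqr_ge0 // expr1n => /eqP xy1.
have x_itv : -1 <= x <= 1.
  rewrite -ler_norml -(@expr_le1 _ 2%N) ?normr_ge0 // -normrX ger0_norm ?sqr_ge0 //.
  by rewrite -xy1 lerDl sqr_ge0.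
have sin_x : sin (acos x) = `|y|.
  by rewrite sin_acos // -xy1 addrAC subrr add0r sqrtr_sqr.
have cos_x : cos (acos x) = x by rewrite acosK.
(* acos takes its values in [0, pi], where sin is nonnegative. *)
have [y_ge0|y_lt0] := leP 0 y.
  by exists (acos x); rewrite /expi cos_x sin_x ger0_norm.
by exists (- acos x); rewrite /expi cosN sinN cos_x sin_x ltr0_norm ?opprK.
Qed.

Lemma expi_root_inj (R : realType) (N : nat) :
  injective (fun k : 'I_N => expi (- (2 * pi * (k : nat)%:R / N%:R)) : R[i]).
Proof.
move=> k l /=.
wlog lt_kl : k l / (k < l)%N => [wlt|].
  case: (ltngtP k l) => [lt_kl|lt_lk eq_kl|/val_inj //]; first exact: wlt.
  by apply/esym; apply: wlt.
have N_gt0 : 0 < N%:R :> R by rewrite ltr0n (leq_ltn_trans _ (ltn_ord k)).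
set u := - _; set v := - _ => eq_uv.
have /eqP[] : expi (u - v) != 1.
  apply: expi_neq1.
  have -> : u - v = 2 * pi * ((l : nat)%:R - (k : nat)%:R) / N%:R.
    by rewrite /u /v opprK addrC mulrBr mulrBl.
  have kl_gt0 : 0 < (l : nat)%:R - (k : nat)%:R :> R by rewrite subr_gt0 ltr_nat.
  rewrite divr_gt0 ?mulr_gt0 ?pi_gt0 //= ltr_pdivrMr // -(mulr_natl pi).
  rewrite ltr_pM2l ?mulr_gt0 ?pi_gt0 // ltrBlDr -natrD ltr_nat.
  exact: leq_trans (ltn_ord l) (leq_addr _ _).
have v_neq0 : expi v != 0 by rewrite -normr_gt0 norm_expi.
by apply: (mulIf v_neq0); rewrite mul1r -expiD subrK.
Qed.

(** * Discrete Fourier transforms as polynomial values *)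

Lemma dft_horner (R : realType) (N : nat) (f : 'rV[R[i]]_N) (k : 'I_N) :
  dft f 0 k = (rVpoly f).[expi (- (2 * pi * (k : nat)%:R / N%:R))].
Proof.
rewrite mxE horner_poly; apply: eq_bigr => s _.
rewrite valK -expiX -[(- _) *+ s]mulr_natr mulNr; congr (_ * expi (- _)).
by rewrite [2 * pi * s%:R * _]mulrAC [LHS]mulrAC.
Qed.

Lemma rVpoly_damp (R : realType) (N : nat) (alpha : R) (f : 'rV[R[i]]_N) :
  rVpoly (damp alpha f) = dilate (expR (- alpha))%:C (rVpoly f).
Proof.
apply/polyP => s; rewrite coef_dilate !coef_poly.
case: ltnP => [lt_s|]; last by rewrite mul0r.
rewrite insubT mxE; congr (_ * _).
by rewrite -rmorphXn -expRM_natl /= mulrN.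
Qed.

Lemma size_rVpoly_support (K : nzRingType) (N n : nat) (f : 'rV[K]_N) :
  (forall s : 'I_N, (n <= s)%N -> f 0 s = 0) -> (size (rVpoly f) <= n)%N.
Proof.
move=> f0; apply/leq_sizeP => s le_ns; rewrite coef_poly.
case: ltnP => // lt_s; rewrite insubT; exact: f0.
Qed.

Lemma eq_dft_autocorrelation {R : realType} {m : nat}
    {f g : 'rV[R[i]]_(2 * m.+1 - 1)} :
  (size (rVpoly f) <= m.+1)%N -> (size (rVpoly g) <= m.+1)%N ->
  modulus (dft f) = modulus (dft g) ->
  rVpoly f * reciprocal m (rVpoly f) = rVpoly g * reciprocal m (rVpoly g).
Proof.
move=> le_f le_g eq_fg; set N := (2 * m.+1 - 1)%N in f g le_f le_g eq_fg *.
pose w (k : 'I_N) : R[i] := expi (- (2 * pi * (k : nat)%:R / N%:R)).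
apply: (@eq_autocorrelation _ m _ _ [seq w k | k <- enum 'I_N]) => //.
- by rewrite map_inj_uniq ?enum_uniq //; apply: expi_root_inj.
- by rewrite size_map size_enum_ord /N mul2n doubleS subn1.
move=> _ /mapP[k _ ->]; split; first exact: norm_expi.
have /matrixP/(_ 0 k) := eq_fg.
by rewrite !mxE -!dft_horner !mxE.
Qed.

Local Close Scope complex_scope.

Theorem theorem2p7 (R : realType) (alpha : R) (n : nat)
    (f g : 'rV[R[i]]_(2 * n - 1)) :
  0 < alpha ->
  (1 <= n)%N ->
  (forall s : 'I_(2 * n - 1), (n <= s)%N -> f 0 s = 0 /\ g 0 s = 0) ->
  modulus (dft f) = modulus (dft g) ->
  modulus (dft (damp alpha f)) = modulus (dft (damp alpha g)) ->
  exists phi : R, f = expi phi *: g.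
Proof.
case: n f g => // m f g alpha_gt0 _ supp eq_fg eq_damp.
have size_f : (size (rVpoly f) <= m.+1)%N.
  by apply: size_rVpoly_support => s /supp[].
have size_g : (size (rVpoly g) <= m.+1)%N.
  by apply: size_rVpoly_support => s /supp[].
have size_df : (size (rVpoly (damp alpha f)) <= m.+1)%N.
  by apply: size_rVpoly_support => s /supp[f0 _]; rewrite mxE f0 mul0r.
have size_dg : (size (rVpoly (damp alpha g)) <= m.+1)%N.
  by apply: size_rVpoly_support => s /supp[_ g0]; rewrite mxE g0 mul0r.
set r : R[i] := (expR (- alpha))%:C%C.
have r_gt0 : 0 < r by rewrite ltcR expR_gt0.
have r_neq1 : r != 1.
  by rewrite lt_eqF // -[1]/(1%:C)%C ltcR expR_lt1 oppr_lt0.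
have auto := eq_dft_autocorrelation size_f size_g eq_fg.
have := eq_dft_autocorrelation size_df size_dg eq_damp.
rewrite !rVpoly_damp => auto_damp.
have [c [/norm1_expi[phi ->] eq_poly]] :=
  eq_up_to_phase_of_autocorrelations
    r_gt0 r_neq1 size_f size_g auto auto_damp.
exists phi; apply: (can_inj rVpolyK); rewrite eq_poly.
by rewrite linearZ.
Qed.
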